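(* Consider a GMCLP instance $(\mathcal{I},\mathcal{J},(\mathcal{I}_j)_{j\in\mathcal{J}},(w_j)_{j\in\mathcal{J}},p)$ together with the data $\mathcal{J}',\mathcal{J}_k,w'_k,\mathcal{N}',\mathcal{P}_k,\mathcal{N}_k$ of its isomorphic aggregation. Let $\mathcal{Y}_{\mathrm{L}}=\{y\in[0,1]^{|\mathcal{I}|}: y(\mathcal{I})=p\}$, $$z_{\mathrm{LP}}=\max_{y\in\mathcal{Y}_{\mathrm{L}}}\Big\{\sum_{j\in\mathcal{N}}w_j\cdot\max_{i\in\mathcal{I}_j}y_i+\sum_{j\in\mathcal{J}\setminus\mathcal{N}}w_j\cdot\min\{1,y(\mathcal{I}_j)\}\Big\},$$ $$z'_{\mathrm{LP}}=\max_{y\in\mathcal{Y}_{\mathrm{L}}}\Big\{\sum_{k\in\mathcal{N}'}w'_k\cdot\max_{i\in\mathcal{I}_k}y_i+\sum_{k\in\mathcal{J}'\setminus\mathcal{N}'}w'_k\cdot\min\{1,y(\mathcal{I}_k)\}\Big\},$$ and let $y^*$ be an optimal solution of the second maximization problem (the one defining $z'_{\mathrm{LP}}$). For $k\in\mathcal{J}'$ let $f_k(y)=\min\{1,y(\mathcal{I}_k)\}-\max_{i\in\mathcal{I}_k}y_i$. Then $$z_{\mathrm{LP}}-z'_{\mathrm{LP}}\ \ge\ \sum_{k\in\mathcal{N}'}|w(\mathcal{P}_k)|\,f_k(y^* )+\sum_{k\in\mathcal{J}'\setminus\mathcal{N}'}|w(\mathcal{N}_k)|\,f_k(y^* ).$$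 Moreover, if (i) $|w(\mathcal{P}_k)|>0$ and $f_k(y^* )>0$ hold for some $k\in\mathcal{N}'$, or (ii) $|w(\mathcal{N}_k)|>0$ and $f_k(y^* )>0$ hold for some $k\in\mathcal{J}'\setminus\mathcal{N}'$, then $z_{\mathrm{LP}}>z'_{\mathrm{LP}}$.
   Context: A GMCLP (generalized maximal covering location problem) instance consists of finite nonempty sets $\mathcal{I}$ (candidate facility locations) and $\mathcal{J}$ (customers), subsets $\mathcal{I}_j\subseteq\mathcal{I}$ for $j\in\mathcal{J}$, real weights $w_j$ for $j\in\mathcal{J}$ (positive or negative), and an integer $p$ with $1\le p\le|\mathcal{I}|$. Put $\mathcal{N}=\{j\in\mathcal{J}: w_j<0\}$. For a vector $a$ and a subset $\mathcal{S}$ of its index set, $a(\mathcal{S})=\sum_{i\in\mathcal{S}}a_i$. A maximum over an empty index set of components $y_i$ is read as $0$. Isomorphic aggregation: let $\mathcal{I}_{j_1},\dots,\mathcal{I}_{j_\tau}$ be all the distinct sets among $\{\mathcal{I}_j\}_{j\in\mathcal{J}}$, with representatives $\mathcal{J}'=\{j_1,\dots,j_\tau\}\subseteq\mathcal{J}$ (one for each distinct set). For $k\in\mathcal{J}'$ let $\mathcal{J}_k=\{j\in\mathcal{J}:\mathcal{I}_j=\mathcal{I}_k\}$ and $w'_k=w(\mathcal{J}_k)$. Let $\mathcal{N}'=\{k\in\mathcal{J}': w'_k<0\}$. Define $\mathcal{P}_k=\mathcal{J}_k\setminus\mathcal{N}$ for $k\in\mathcal{N}'$ and $\mathcal{N}_k=\mathcal{J}_k\cap\mathcal{N}$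 for $k\in\mathcal{J}'\setminus\mathcal{N}'$. (The values $z_{\mathrm{LP}}$ and $z'_{\mathrm{LP}}$ are the LP relaxation bounds of the GMCLP before and after isomorphic aggregation.) *)

(* Defs.v *)
From HB Require Import structures.
From mathcomp Require Import all_boot all_order all_algebra.
From mathcomp Require Import all_classical all_reals all_analysis.

Set Implicit Arguments.
Unset Strict Implicit.
Unset Printing Implicit Defensive.

Import Order.TTheory GRing.Theory Num.Theory.
Import numFieldNormedType.Exports.

Local Open Scope classical_set_scope.
Local Open Scope ring_scope.

Record gmclp (R : realType) (I J : finType) := Gmclp {
  coverset : J -> {set I};
  weight : J -> R;
  nfac : nat;
  facilities_nonempty : (0 < #|I|)%N;
  customers_nonempty : (0 < #|J|)%N;
  nfac_bounds : (1 <= nfac <= #|I|)%N }.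

Definition subsum (R : realType) (T : finType) (a : T -> R) (S : {set T}) : R :=
  \sum_(i in S) a i.

(* This is the maximum of the y i over S, read as 0 when S is empty, provided
   that y is nonnegative; it is only meant for y in feasibleL below. *)
Definition submax (R : realType) (T : finType) (y : T -> R) (S : {set T}) : R :=
  \big[Num.max/0]_(i in S) y i.

Definition negs (R : realType) (J : finType) (D : {set J}) (w : J -> R) :
  {set J} := [set j in D | w j < 0].

Section Gmclp.
Variables (R : realType) (I J : finType) (G : gmclp R I J).
Implicit Types (D : {set J}) (w : J -> R) (y : I -> R) (j k : J).

Definition feasibleL : set (I -> R) :=
  [set y | (forall i, 0 <= y i <= 1) /\ subsum y [set: I]%SET = (nfac G)%:R].

(* The customer set D and the weights w are parameters so that the same
   definitions serve the original and the aggregated problem. *)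
Definition lp_obj D w y : R :=
  \sum_(j in negs D w) w j * submax y (coverset G j) +
  \sum_(j in D :\: negs D w) w j * Num.min 1 (subsum y (coverset G j)).

(* The supremum is a maximum: see lp_value_max. *)
Definition lp_value D w : R := sup [set lp_obj D w y | y in feasibleL].

Definition lp_optimal D w y : Prop :=
  feasibleL y /\ forall y', feasibleL y' -> lp_obj D w y' <= lp_obj D w y.

Definition zLP : R := lp_value [set: J]%SET (weight G).

Definition is_representatives D : Prop :=
  {in D &, injective (coverset G)} /\
  [set coverset G k | k in D]%SET = [set coverset G j | j in [set: J]%SET]%SET.

Definition iso_class k : {set J} := [set j | coverset G j == coverset G k]%SET.

Definition agg_weight k : R := subsum (weight G) (iso_class k).

Definition zLP_agg D : R := lp_value D agg_weight.

Definition pos_part k : {set J} :=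
  iso_class k :\: negs [set: J]%SET (weight G).

Definition neg_part k : {set J} :=
  iso_class k :&: negs [set: J]%SET (weight G).

Definition gap k y : R :=
  Num.min 1 (subsum y (coverset G k)) - submax y (coverset G k).

Lemma feasibleL_nonempty : feasibleL !=set0.
Proof.
have I0 : #|I|%:R != 0 :> R by rewrite pnatr_eq0 -lt0n (facilities_nonempty G).
exists (fun=> (nfac G)%:R / #|I|%:R); split=> [_|].
  rewrite divr_ge0 ?ler0n//= ler_pdivrMr ?mul1r ?ler_nat.
    by case/andP: (nfac_bounds G).
  by rewrite ltr0n (facilities_nonempty G).
by rewrite /subsum sumr_const finset.cardsT -[LHS]mulr_natr divfK.
Qed.

Let cont_coord i : continuous (fun y : {ptws I -> R} => y i).
Proof. exact: (@proj_continuous I (fun=> R) i). Qed.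

Let cont_subsum (S : {set I}) :
  continuous (fun y : {ptws I -> R} => subsum y S).
Proof.
apply: continuous_big => [|i _]; [exact: add_continuous|exact: cont_coord].
Qed.

Let cont_submax (S : {set I}) :
  continuous (fun y : {ptws I -> R} => submax y S).
Proof.
apply: continuous_big => [|i _]; [exact: max_continuous|exact: cont_coord].
Qed.

Let cont_lp_obj D w : continuous (lp_obj D w : {ptws I -> R} -> R).
Proof.
have c1 : continuous (fun y : {ptws I -> R} =>
    \sum_(j in negs D w) w j * submax y (coverset G j)).
  apply: continuous_big => [|j _ y]; first exact: add_continuous.
  exact: (cvgM (cvg_cst (w j)) (@cont_submax (coverset G j) y)).
have c2 : continuous (fun y : {ptws I -> R} =>
    \sum_(j in D :\: negs D w) w j * Num.min 1 (subsum y (coverset G j))).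
  apply: continuous_big => [|j _ y]; first exact: add_continuous.
  have cm := min_fun_continuous (@cst_continuous {ptws I -> R} R 1)
    (@cont_subsum (coverset G j)).
  exact: (cvgM (cvg_cst (w j)) (cm y)).
move=> y; exact: (cvgD (c1 y) (c2 y)).
Qed.

Let compact_feasibleL : compact (feasibleL : set {ptws I -> R}).
Proof.
have -> : feasibleL = [set y | forall i, `[0, 1]%classic (y i)] `&`
    ((fun y : I -> R => subsum y [set: I]%SET) @^-1` [set (nfac G)%:R]).
  apply/seteqP; split=> y [y01 ys]; split=> // i; move: (y01 i);
  by rewrite /= in_itv.
apply: (@compact_closedI {ptws I -> R}).
  apply: (@tychonoff I (fun=> R) (fun=> `[0, 1]%classic)) => i.
  exact: segment_compact.
by apply: preimage_closed => [y _|]; [exact: cont_subsum|exact: closed_eq].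
Qed.

Lemma lp_optimal_exists D w : exists y, lp_optimal D w y.
Proof.
have [|y] := @compact_EVT_max {ptws I -> R} R (lp_obj D w) _
    feasibleL_nonempty compact_feasibleL.
  by apply: continuous_subspaceT; exact: cont_lp_obj.
rewrite inE => Fy ymax; exists y; split=> // y' Fy'.
by apply: ymax; rewrite inE.
Qed.

Lemma lp_value_optimal D w y : lp_optimal D w y -> lp_value D w = lp_obj D w y.
Proof.
move=> [Fy ymax]; apply/eqP; rewrite eq_le; apply/andP; split.
  apply: ge_sup; first by exists (lp_obj D w y), y.
  by move=> _ [y' Fy' <-]; exact: ymax.
apply: ub_le_sup; last by exists y.
by exists (lp_obj D w y) => _ [y' Fy' <-]; exact: ymax.
Qed.

Lemma lp_value_max D w :
  (exists2 y, feasibleL y & lp_obj D w y = lp_value D w) /\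
  (forall y, feasibleL y -> lp_obj D w y <= lp_value D w).
Proof.
have [y yopt] := lp_optimal_exists D w.
rewrite (lp_value_optimal yopt); case: yopt => Fy ymax.
by split=> //; exists y.
Qed.

End Gmclp.

(* Main.v *)
Require Import Defs.
From mathcomp Require Import all_boot all_order all_algebra.
From mathcomp Require Import all_classical all_reals all_analysis.
From mathcomp Require Import ring.

(** The two LP objectives can be compared at one and the same point [y], and
there the difference is an exact identity ([lp_obj_sub_agg]).  A customer
contributes [w] times either the maximum or the truncated sum of [y] over its
cover set, according to the sign of [w], and these two numbers depend only on
the isomorphism class.  So the class of [k] contributes
[w(N_k) * max + w(P_k) * min] before aggregation, whereas after aggregation the
whole weight [w(N_k) + w(P_k)] is charged at the maximum or at the truncated sum
according to the sign of the total.  The customers whose own sign disagrees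
with that of the total are exactly the ones charged differently, and the change
is [|w(P_k)|] or [|w(N_k)|] times [gap k y] ([class_contrib_neg],
[class_contrib_pos]).

At [y = ystar] the aggregated objective is the aggregated LP value, while the
original objective is at most the original LP value: this is the inequality.
For strictness, every gap is nonnegative on the feasible set ([gap_ge0]), so a
single positive term makes the lower bound positive. *)

Import Order.TTheory GRing.Theory Num.Theory.
Local Open Scope ring_scope.

Section Aggregation.
Context {R : realType} {I J : finType} (G : gmclp R I J).
Implicit Types (D : {set J}) (w : J -> R) (y : I -> R) (j k : J).

Local Notation w := (weight G).
Local Notation maxy y k := (submax y (coverset G k)).
Local Notation miny y k := (Num.min 1 (subsum y (coverset G k))).

(** Choosing between maximum and truncated sum termwise, instead of splitting
the index set, is what allows the objective to be regrouped by class. *)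
Definition contrib (a : R) y k : R := a * (if a < 0 then maxy y k else miny y k).

Lemma lp_obj_contrib D v y :
  lp_obj G D v y = \sum_(j in D) contrib (v j) y j.
Proof.
rewrite /lp_obj [RHS](big_setID (negs D v))/=.
have /finset.setIidPr -> : negs D v \subset D.
  by apply/fintype.subsetP => j; rewrite inE => /andP[].
congr (_ + _); apply: eq_bigr => j; rewrite !inE /contrib.
  by case/andP=> _ ->.
by case/andP=> + jD; rewrite jD /= => /negbTE ->.
Qed.

Lemma sum_iso_class D (F : J -> R) : is_representatives G D ->
  \sum_(j in finset.setT) F j = \sum_(k in D) \sum_(j in iso_class G k) F j.
Proof.
case=> Dinj Dim.
transitivity (\sum_(S in [set coverset G k | k in D]%SET)
    \sum_(j | coverset G j == S) F j).
  rewrite Dim [LHS](partition_big_imset (coverset G))/=.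
  by apply: eq_bigr => S _; apply: eq_bigl => j; rewrite inE.
rewrite big_imset//=.
by apply: eq_bigr => k _; apply: eq_bigl => j; rewrite inE.
Qed.

Lemma weight_pos_part_ge0 k : 0 <= subsum w (pos_part G k).
Proof. by apply: sumr_ge0 => j; rewrite !inE/= -leNgt => /andP[]. Qed.

Lemma weight_neg_part_le0 k : subsum w (neg_part G k) <= 0.
Proof. by apply: sumr_le0 => j; rewrite !inE/= => /andP[_ /ltW]. Qed.

Lemma agg_weight_split k :
  agg_weight G k = subsum w (neg_part G k) + subsum w (pos_part G k).
Proof. by rewrite /agg_weight /subsum (big_setID (negs finset.setT w)). Qed.

Lemma class_contrib y k :
  \sum_(j in iso_class G k) contrib (w j) y j =
  subsum w (neg_part G k) * maxy y k + subsum w (pos_part G k) * miny y k.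
Proof.
rewrite (big_setID (negs finset.setT w))/= /subsum !mulr_suml.
congr (_ + _); apply: eq_bigr => j; rewrite !inE/= /contrib.
  by case/andP=> /eqP -> ->.
by case/andP=> /negbTE -> /eqP ->.
Qed.

(** The nonnegative customers of the class are charged at the truncated sum
before aggregation and at the maximum after it. *)
Lemma class_contrib_neg y k : agg_weight G k < 0 ->
  \sum_(j in iso_class G k) contrib (w j) y j =
  contrib (agg_weight G k) y k + `|subsum w (pos_part G k)| * gap G k y.
Proof.
move=> k_lt0; rewrite class_contrib /contrib k_lt0 agg_weight_split.
by rewrite (ger0_norm (weight_pos_part_ge0 k)) /gap; ring.
Qed.

(** The negative customers of the class are charged at the maximum before
aggregation and at the truncated sum after it. *)
Lemma class_contrib_pos y k : 0 <= agg_weight G k ->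
  \sum_(j in iso_class G k) contrib (w j) y j =
  contrib (agg_weight G k) y k + `|subsum w (neg_part G k)| * gap G k y.
Proof.
move=> k_ge0; rewrite class_contrib /contrib ltNge k_ge0 /= agg_weight_split.
by rewrite (ler0_norm (weight_neg_part_le0 k)) /gap; ring.
Qed.

(** Summing the class identities gives an equality at every [y], feasible or
not; all the inequality of the main result comes from optimality. *)
Lemma lp_obj_sub_agg D y : is_representatives G D ->
  lp_obj G finset.setT w y - lp_obj G D (agg_weight G) y =
  \sum_(k in negs D (agg_weight G))
    `|subsum w (pos_part G k)| * gap G k y +
  \sum_(k in D :\: negs D (agg_weight G))
    `|subsum w (neg_part G k)| * gap G k y.
Proof.
move=> Drep; rewrite !lp_obj_contrib (sum_iso_class _ _ Drep) -sumrB.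
rewrite (big_setID (negs D (agg_weight G)))/=.
have /finset.setIidPr -> : negs D (agg_weight G) \subset D.
  by apply/fintype.subsetP => j; rewrite inE => /andP[].
congr (_ + _); apply: eq_bigr => k; rewrite !inE.
  by case/andP=> _ k_lt0; rewrite class_contrib_neg// addrC addKr.
case/andP=> + kD; rewrite kD /= -leNgt => k_ge0.
by rewrite class_contrib_pos// addrC addKr.
Qed.

(** Each coordinate in the cover set is at most 1 and, the others being
nonnegative, at most the sum. *)
Lemma gap_ge0 k y : feasibleL G y -> 0 <= gap G k y.
Proof.
case=> y01 _; rewrite /gap subr_ge0.
have y_ge0 i : 0 <= y i by case/andP: (y01 i).
apply: bigmax_le => [|i iS]; first by rewrite le_min ler01 sumr_ge0.
rewrite le_min; have /andP[_ ->] /= := y01 i.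
by rewrite /subsum (bigD1 i)//= lerDl sumr_ge0.
Qed.

End Aggregation.

Lemma psumr_gt0_in (R : numDomainType) (T : finType) (A : {set T})
    (F : T -> R) (x : T) :
  (forall i, 0 <= F i) -> x \in A -> 0 < F x -> 0 < \sum_(i in A) F i.
Proof.
move=> F_ge0 xA Fx; rewrite (bigD1 x)//=.
by rewrite ltr_wpDr// sumr_ge0.
Qed.

Theorem corollary3p4 (R : realType) (I J : finType) (G : gmclp R I J)
    (J' : {set J}) (hJ' : is_representatives G J')
    (ystar : I -> R) (hystar : lp_optimal G J' (agg_weight G) ystar) :
  let N' := negs J' (agg_weight G) in
  zLP G - zLP_agg G J' >=
    \sum_(k in N') `|subsum (weight G) (pos_part G k)| * gap G k ystar +
    \sum_(k in J' :\: N') `|subsum (weight G) (neg_part G k)| * gap G k ystar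
  /\
  ((exists k, [/\ k \in N', `|subsum (weight G) (pos_part G k)| > 0
                          & gap G k ystar > 0]) \/
   (exists k, [/\ k \in J' :\: N', `|subsum (weight G) (neg_part G k)| > 0
                          & gap G k ystar > 0]) ->
   zLP G > zLP_agg G J').
Proof.
move=> N'; have [Fy _] := hystar.
have bound : zLP G - zLP_agg G J' >=
    \sum_(k in N') `|subsum (weight G) (pos_part G k)| * gap G k ystar +
    \sum_(k in J' :\: N') `|subsum (weight G) (neg_part G k)| * gap G k ystar.
  rewrite -(lp_obj_sub_agg _ _ _ hJ') /zLP_agg (lp_value_optimal hystar) lerB//.
  by have [_] := lp_value_max G finset.setT (weight G); exact.
split=> // strict; rewrite -subr_gt0; apply: lt_le_trans bound.
have term_ge0 a k : 0 <= `|a| * gap G k ystar by rewrite mulr_ge0// gap_ge0.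
case: strict => -[k [kA a_gt0 g_gt0]].
  by rewrite ltr_wpDr ?sumr_ge0// (psumr_gt0_in _ _ _ _ k)// mulr_gt0.
by rewrite ltr_wpDl ?sumr_ge0// (psumr_gt0_in _ _ _ _ k)// mulr_gt0.
Qed.
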